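(* For every $n\geq 8$ there exists a simple graph $G$ on $n$ vertices such that $G$ and its complement $\overline{G}$ are both connected and $rc(G)=rc(\overline{G})=2$; in particular the lower bound $rc(G)+rc(\overline{G})\geq 4$ (valid whenever $G$ and $\overline{G}$ are both connected) is attained for every $n\geq 8$.
   Context: All graphs are simple, finite and undirected. For a connected graph $G$, an edge coloring $c:E(G)\to\{1,\dots,k\}$ (adjacent edges may receive the same color) makes $G$ rainbow connected if for every two vertices $u,v$ there is a $u$–$v$ path whose edges have pairwise distinct colors; $rc(G)$ is the minimum such $k$. $\overline{G}$ denotes the complement of $G$. *)

(* Defs.v *)
From mathcomp Require Import all_boot.
From mathcomp Require Import boolp.

Set Implicit Arguments.
Unset Strict Implicit.
Unset Printing Implicit Defensive.

Record sgraph (T : finType) := SGraph {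
  adj :> rel T;
  adj_sym : symmetric adj;
  adj_irr : irreflexive adj
}.

Definition edges (T : finType) (G : sgraph T) : {set {set T}} :=
  [set [set xy.1; xy.2] | xy : T * T & G xy.1 xy.2].

Definition connected (T : finType) (G : sgraph T) : Prop :=
  forall x y : T, connect G x y.

Definition cadj (T : finType) (G : sgraph T) : rel T :=
  [rel x y | (x != y) && ~~ G x y].

Lemma cadj_sym (T : finType) (G : sgraph T) : symmetric (cadj G).
Proof. by move=> x y; rewrite /cadj /= eq_sym adj_sym. Qed.

Lemma cadj_irr (T : finType) (G : sgraph T) : irreflexive (cadj G).
Proof. by move=> x; rewrite /cadj /= eqxx. Qed.

Definition complement (T : finType) (G : sgraph T) : sgraph T :=
  SGraph (@cadj_sym T G) (@cadj_irr T G).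

(* Colourings are functions on all subsets of T; only their values on edges
   matter, and only those are required to lie in {1, ..., k}. *)
Definition edge_coloring (T : finType) (G : sgraph T) (k : nat)
    (c : {set T} -> nat) : Prop :=
  forall A, A \in edges G -> 1 <= c A <= k.

(* The path visits x :: p; its i-th edge joins consecutive vertices. *)
Definition rainbow_path (T : finType) (G : sgraph T) (c : {set T} -> nat)
    (x y : T) (p : seq T) : bool :=
  [&& path G x p, last x p == y, uniq (x :: p)
    & uniq (pairmap (fun a b => c [set a; b]) x p)].

Definition rainbow_connected (T : finType) (G : sgraph T)
    (c : {set T} -> nat) : Prop :=
  forall x y : T, exists p : seq T, rainbow_path G c x y p.

Definition rainbow_colorable (T : finType) (G : sgraph T) (k : nat) : Prop :=
  exists2 c, edge_coloring G k c & rainbow_connected G c.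

(* The least k for which G is rainbow colourable with k colours. The junk
   value 0 is taken only by disconnected graphs, see [rcP]. *)
Definition rc (T : finType) (G : sgraph T) : nat :=
  if pselect (exists k, `[< rainbow_colorable G k >]) is left ex
  then ex_minn ex else 0.

Lemma connected_colorable (T : finType) (G : sgraph T) :
  connected G -> exists k, rainbow_colorable G k.
Proof.
move=> cG; exists #|{set T}|, (fun A => (enum_rank A).+1) => [A _|x y].
  by rewrite /= ltn_ord.
have /connectP[p0 /shortenP[p pG up _] ->] := cG x y.
exists p; rewrite /rainbow_path pG eqxx up /=.
elim: p x up {pG cG p0} => //= z p IHp x /andP[xNzp uzp].
rewrite IHp // andbT; apply/negP => /(nthP 0)[i].
rewrite size_pairmap => lt_ip; rewrite (nth_pairmap z) // => -[].
move=> /ord_inj/enum_rank_inj/setP/(_ x); rewrite !inE eqxx /=.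
case/orP=> /eqP xE; move: xNzp; rewrite xE.
  by rewrite mem_nth // ltnW.
by rewrite inE mem_nth // orbT.
Qed.

Lemma rcP (T : finType) (G : sgraph T) : connected G ->
  rainbow_colorable G (rc G) /\ (forall k, rainbow_colorable G k -> rc G <= k).
Proof.
move=> cG; rewrite /rc; case: pselect => [ex|[]].
  by case: ex_minnP => m /asboolP ? le_m; split=> // k /asboolP/le_m.
by have [k /asboolP ?] := connected_colorable cG; exists k.
Qed.

(* Main.v *)
Require Import Defs.
From mathcomp Require Import all_boot.
From mathcomp Require Import zify.

Set Implicit Arguments.
Unset Strict Implicit.
Unset Printing Implicit Defensive.

(** On the vertices 0, ..., n-1, give each pair i < j a label in {0, 1, 2, 3}
    depending only on the parity of i and on min(j - i, 7): labels 0 and 1 are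
    edges of G, labels 2 and 3 are edges of the complement, and the parity of
    the label is the colour.  It suffices that every pair {i, j} has a third
    vertex z such that iz and zj carry the two labels of the class opposite to
    that of ij.  If j - i > 7, then z = i + 1 works.  Otherwise an even
    translation, which preserves labels, brings the pair into the initial
    segment of 8 or 9 vertices, where the property is checked by computation. *)

Lemma rainbow_connected_connected (T : finType) (G : sgraph T) c :
  rainbow_connected G c -> connected G.
Proof.
move=> rG x y; have [p /and4P[pG /eqP <- _ _]] := rG x y.
by apply/connectP; exists p.
Qed.

Lemma connected_edge (T : finType) (G : sgraph T) :
  1 < #|T| -> connected G -> exists x y, G x y.
Proof.
move=> /card_gt1P[x [y [_ _ neq_xy]]] /(_ x y)/connectP[[|z p] /=].
  by move=> _ eq_yx; rewrite eq_yx eqxx in neq_xy.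
by move=> /andP[Gxz _] _; exists x, z.
Qed.

(** A rainbow path from [x] to [y] has at least two edges, and its first two carry distinct colours
    between 1 and [rc G]. *)
Lemma rc_gt1 (T : finType) (G : sgraph T) x y :
  connected G -> x != y -> ~~ G x y -> 1 < rc G.
Proof.
move=> cG neq_xy nGxy; have [[c cP rP] _] := rcP cG.
have [p] := rP x y; case: p => [|a [|b p]] /and4P[].
- by move=> _ /= /eqP eq_xy; rewrite eq_xy eqxx in neq_xy.
- by move=> /= /andP[Gxa _] /eqP eq_ay; rewrite -eq_ay Gxa in nGxy.
move=> /and3P[Gxa Gab _] _ _ /= /andP[].
rewrite inE negb_or => /andP[neq_c _] _.
have edge u v : G u v -> 1 <= c [set u; v] <= rc G.
  by move=> Guv; apply/cP/imsetP; exists (u, v); rewrite ?inE.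
have := edge _ _ Gxa; have := edge _ _ Gab.
by move: neq_c; lia.
Qed.

(** An edge of either graph is a pair of distinct non-adjacent vertices of the other. *)
Lemma rc_complement_gt1 (T : finType) (G : sgraph T) :
  1 < #|T| -> connected G -> connected (complement G) ->
  1 < rc G /\ 1 < rc (complement G).
Proof.
move=> T_gt1 cG cG'; split.
  have [x [y /andP[neq_xy nGxy]]] := connected_edge T_gt1 cG'.
  exact: rc_gt1 nGxy.
have [x [y Gxy]] := connected_edge T_gt1 cG.
have neq_xy : x != y by apply: contraTneq Gxy => ->; rewrite adj_irr.
by apply: (rc_gt1 cG' neq_xy); rewrite /= negb_and Gxy orbT.
Qed.

(** Adjacent vertices are joined by their edge, all others by the two-edge path through [z]. *)
Lemma colorable2 (T : finType) (G : sgraph T) (c : rel T) :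
    symmetric c ->
    (forall x y, x != y -> ~~ G x y ->
       exists z, [/\ G x z, G z y & c x z != c z y]) ->
  rainbow_colorable G 2.
Proof.
move=> c_sym mid.
(* Colourings act on sets, so the relation [c] is transported to unordered pairs; the successor
   turns its values 0 and 1 into the colours 1 and 2. *)
pose d (A : {set T}) :=
  [exists u, exists v, (A == [set u; v]) && c u v].+1.
have dE x y : d [set x; y] = (c x y).+1.
  congr _.+1; congr nat_of_bool; apply/existsP/idP => [[u]|cxy]; last first.
    by exists x; apply/existsP; exists y; rewrite eqxx.
  case/existsP=> v /andP[/eqP eqA cuv].
  (* The four memberships force (u, v) to be (x, y) or (y, x); symmetry of [c] settles the swap. *)
  have: x \in [set u; v] by rewrite -eqA set21.
  have: y \in [set u; v] by rewrite -eqA set22.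
  have: u \in [set x; y] by rewrite eqA set21.
  have: v \in [set x; y] by rewrite eqA set22.
  rewrite !inE => /orP[]/eqP vE /orP[]/eqP uE; subst u v;
    by rewrite ?orbb => /eqP yE /eqP xE; subst; rewrite // c_sym.
exists d => [A _|x y]; first by rewrite /d; case: [exists u, _].
have [<-|neq_xy] := eqVneq x y.
  by exists [::]; rewrite /rainbow_path /= eqxx.
have neq_adj u v : G u v -> u != v.
  by move=> Guv; apply: contraTneq Guv => ->; rewrite adj_irr.
have [Gxy|nGxy] := boolP (G x y).
  by exists [:: y]; rewrite /rainbow_path /= Gxy eqxx inE neq_xy.
have [z [Gxz Gzy neq_c]] := mid x y neq_xy nGxy.
exists [:: z; y]; rewrite /rainbow_path /= Gxz Gzy eqxx !inE negb_or !dE.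
by rewrite neq_xy !neq_adj // eqSS; move: neq_c; do 2 case: (c _ _).
Qed.

(* The two rows come from a computer search;
   [label i i] is a junk value. *)
Definition label (i j : nat) : nat :=
  nth 0 (if odd (minn i j) then [:: 1; 2; 0; 1; 0; 3; 3]
                           else [:: 2; 3; 1; 3; 0; 2; 0])
        (minn (maxn i j - minn i j) 7).-1.

(** The third-vertex property, stated on naturals as a boolean so that small cases can be
    evaluated. *)
Definition bridge (i j z : nat) : bool :=
  [&& z != i, z != j, (label i z < 2) == (2 <= label i j),
      (label z j < 2) == (2 <= label i j)
    & odd (label i z) != odd (label z j)].

Lemma label_sym i j : label i j = label j i.
Proof. by rewrite /label minnC maxnC. Qed.

Lemma label_shift s i j : ~~ odd s -> label (s + i) (s + j) = label i j.
Proof.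
by move=> s_even; rewrite /label -addn_minr -addn_maxr subnDl oddD (negbTE s_even).
Qed.

Lemma bridge_sym i j z : bridge i j z = bridge j i z.
Proof.
rewrite /bridge (label_sym j i) (label_sym j z) (label_sym z i).
by rewrite [odd (label z j) == _]eq_sym; do !bool_congr; rewrite andbCA.
Qed.

Lemma bridge_shift s i j z : ~~ odd s ->
  bridge (s + i) (s + j) (s + z) = bridge i j z.
Proof. by move=> s_even; rewrite /bridge !label_shift // !eqn_add2l. Qed.

(** Both long distances are truncated to 7, so the pairs (i, j), (i, i+1), (i+1, j) have labels 0,
    2, 3 for even [i] and 3, 1, 0 for odd [i]. *)
Lemma bridge_far i j : i + 7 < j -> bridge i j i.+1.
Proof.
move=> lt_ij; rewrite /bridge /label.
have -> : minn i j = i by lia.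
have -> : minn i i.+1 = i by lia.
have -> : minn i.+1 j = i.+1 by lia.
have -> : minn (maxn i j - i) 7 = 7 by lia.
have -> : minn (maxn i i.+1 - i) 7 = 1 by lia.
have -> : minn (maxn i.+1 j - i.+1) 7 = 7 by lia.
have [-> ->] : i.+1 != i /\ i.+1 != j by lia.
by rewrite oddS; case: (odd i).
Qed.

Lemma bridge_small n i j : 8 <= n <= 9 -> i < j < n ->
  exists2 z, z < n & bridge i j z.
Proof.
move=> n_bnd /andP[lt_ij lt_jn].
suff /hasP[z] : has (bridge i j) (iota 0 n).
  by rewrite mem_iota => ltzn bz; exists z.
(* Quantifying over all pairs below [m] makes the premise a closed boolean once [m] is 8 or 9. *)
have check m : all (fun k => all (fun l => has (bridge l k) (iota 0 m)) (iota 0 k))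
    (iota 0 m) -> j < m -> has (bridge i j) (iota 0 m).
  move=> /allP/(_ j) + lt_jm; rewrite mem_iota => /(_ lt_jm)/allP; apply.
  by rewrite mem_iota.
have /orP[/eqP En|/eqP En] : (n == 8) || (n == 9) by lia.
  by subst n; apply: check lt_jn; vm_compute.
by subst n; apply: check lt_jn; vm_compute.
Qed.

Lemma bridge_lt n i j : 8 <= n -> i < j < n -> exists2 z, z < n & bridge i j z.
Proof.
move=> n_ge8 /andP[lt_ij lt_jn].
have [far|near] := ltnP (i + 7) j; first by exists i.+1; [lia | apply: bridge_far].
(* The largest even shift that stays below [i] and leaves at least 8 vertices. If i <= n - 8, then i
   - s <= 1 and j - s <= 8; otherwise n - s is 8 or 9. Either way the pair falls in the checked
   segment. *)
pose s := (minn i (n - 8))./2.*2.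
have s_even : ~~ odd s by rewrite odd_double.
have [z ltz bz] : exists2 z, z < minn (n - s) 9 & bridge (i - s) (j - s) z.
  by apply: bridge_small; rewrite /s; lia.
exists (s + z); first by lia.
have -> : i = s + (i - s) by rewrite /s; lia.
have -> : j = s + (j - s) by rewrite /s; lia.
by rewrite bridge_shift.
Qed.

Lemma bridge_ord n (i j : 'I_n) : 8 <= n -> i != j -> exists z : 'I_n, bridge i j z.
Proof.
move=> n_ge8; have [lt_ij|lt_ji|/val_inj ->] := ltngtP i j; last by rewrite eqxx.
  have [||z ltzn bz] := @bridge_lt n i j; rewrite ?lt_ij ?ltn_ord //.
  by exists (Ordinal ltzn).
have [||z ltzn bz] := @bridge_lt n j i; rewrite ?lt_ji ?ltn_ord //.
by exists (Ordinal ltzn); rewrite bridge_sym.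
Qed.

Definition label_rel n : rel 'I_n :=
  fun i j => (i != j) && (label i j < 2).

Lemma label_rel_sym n : symmetric (@label_rel n).
Proof. by move=> i j; rewrite /label_rel eq_sym label_sym. Qed.

Lemma label_rel_irr n : irreflexive (@label_rel n).
Proof. by move=> i; rewrite /label_rel eqxx. Qed.

Definition label_graph n : sgraph 'I_n :=
  SGraph (@label_rel_sym n) (@label_rel_irr n).

Lemma label_graph_colorable n : 8 <= n ->
  rainbow_colorable (label_graph n) 2 /\
  rainbow_colorable (complement (label_graph n)) 2.
Proof.
(* The same [c] serves both graphs, since parity separates 0 from 1 and 2 from 3. *)
move=> n_ge8; pose c : rel 'I_n := fun i j => odd (label i j).
have c_sym : symmetric c by move=> i j; rewrite /c label_sym.
split; apply: (colorable2 c_sym) => i j neq_ij.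
all: have [z /and5P[zi zj /eqP iz /eqP jz neq_c]] := bridge_ord n_ge8 neq_ij.
all: rewrite /= /cadj /= /label_rel neq_ij /= => nG; exists z.
all: rewrite [i == z]eq_sym -!val_eqE zi zj iz jz /= leqNgt.
  by rewrite nG.
by rewrite negbK in nG; rewrite nG.
Qed.

Lemma label_graph_rc n : 8 <= n ->
  [/\ connected (label_graph n), connected (complement (label_graph n)),
      rc (label_graph n) = 2 & rc (complement (label_graph n)) = 2].
Proof.
move=> n_ge8; have [col col'] := label_graph_colorable n_ge8.
have cG : connected (label_graph n).
  by have [d _ /rainbow_connected_connected] := col.
have cG' : connected (complement (label_graph n)).
  by have [d _ /rainbow_connected_connected] := col'.
have [|gt1 gt1'] := rc_complement_gt1 _ cG cG'; first by rewrite card_ord; lia.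
split=> //; apply/eqP; rewrite eqn_leq ?gt1 ?gt1' andbT.
  exact: (rcP cG).2.
exact: (rcP cG').2.
Qed.

Theorem theorem3 :
  [/\ forall n : nat, 8 <= n ->
        exists G : sgraph 'I_n,
          [/\ connected G, connected (complement G),
              rc G = 2 & rc (complement G) = 2],
      forall (T : finType) (G : sgraph T), 2 <= #|T| ->
        connected G -> connected (complement G) ->
        4 <= rc G + rc (complement G)
    & forall n : nat, 8 <= n ->
        exists G : sgraph 'I_n,
          [/\ connected G, connected (complement G)
            & rc G + rc (complement G) = 4]].
Proof.
split=> [n n_ge8|T G T_gt1 cG cG'|n n_ge8].
- by exists (label_graph n); apply: label_graph_rc.
- by have [gt1 gt1'] := rc_complement_gt1 T_gt1 cG cG'; rewrite (leq_add gt1 gt1').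
by exists (label_graph n); have [? ? -> ->] := label_graph_rc n_ge8.
Qed.
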